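(* Let $g,h\ge 0$ and $m\ge 2$ be integers and $n=g+h+m$. Let $G$ be the path-clique-path graph obtained from the complete graph $K_m$ with two distinct chosen vertices $u,v$ by attaching a pendant path of length $g$ at $u$ and a pendant path of length $h$ at $v$ (the paths being vertex-disjoint apart from their endpoints in $K_m$; so $G$ has $n$ vertices). Then \[ \frac{X_{G}}{(m-2)!}=(m-1)e_n+\sum_{\substack{I\vDash n\\ \Theta_I(h+1)\ge m-1}} (m-2)\, i_{-1}\, w_{I\backslash i_{-1}}\, e_I+\sum_{\substack{I\vDash n\\ i_{-1}\ge m-1}} (i_{-1}-m+1)\, w_{I\backslash i_{-1}}\, e_I, \] and all coefficients in this expansion are nonnegative.
   Context: All graphs are finite simple graphs. The chromatic symmetric function of a graph $G$ is $X_G=\sum_{\kappa}\prod_{v\in V(G)}x_{\kappa(v)}$, where $\kappa$ ranges over proper colorings $\kappa:V(G)\to\{1,2,\dots\}$. $e_k$ is the $k$-th elementary symmetric function. A composition $I=i_1\dotsm i_\ell$ of $n$ ($I\vDash n$) is a sequence of positive integers with sum $n$; $\ell(I)=\ell$; $i_{-1}=i_\ell$ is the last part and $I\backslash i_{-1}=i_1\dotsm i_{\ell-1}$. Define $e_I=e_{i_1}\dotsm e_{i_\ell}$ and $w_I=i_1(i_2-1)\dotsm(i_\ell-1)$, with $w$ of the empty composition equal to $1$. For a number $t\le n$, $\sigma_I(t)=\min\{i_1+\dots+i_j:0\le j\le\ell(I),\ i_1+\dots+i_j\ge t\}$ and $\Theta_I(t)=\sigma_I(t)-t$. *)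

(* Defs.v *)
From mathcomp Require Import all_boot all_order all_algebra.
From mathcomp Require Import mpoly.
Unset Printing Implicit Defensive.
Import GRing.Theory.
Local Open Scope ring_scope.

(* The path-clique-path graph on vertex set 'I_n, n = g + h + m:
   vertices 0..g-1 form the pendant path of length g attached at u = g,
   vertices g..g+m-1 form the clique K_m, v = g+m-1,
   vertices g+m..n-1 form the pendant path of length h attached at v. *)
Definition pcp_adj (g h m : nat) (x y : nat) : bool :=
  (x != y) &&
  [|| ((x <= g)%N && (y <= g)%N && ((x == y.+1) || (y == x.+1))),
      ((g <= x)%N && (x < g + m)%N && (g <= y)%N && (y < g + m)%N)
    | ((g + m - 1 <= x)%N && (g + m - 1 <= y)%N && ((x == y.+1) || (y == x.+1)))].

Definition pcp_graph (g h m : nat) : rel 'I_(g + h + m) :=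
  fun x y => pcp_adj g h m x y.

Definition proper_col (V : finType) (E : rel V) (N : nat) (k : {ffun V -> 'I_N}) : bool :=
  [forall x, forall y, E x y ==> (k x != k y)].

Definition chromsym (V : finType) (E : rel V) (N : nat) : {mpoly rat[N]} :=
  \sum_(k : {ffun V -> 'I_N} | proper_col V E N k) \prod_(x : V) 'X_(k x).

Definition eI (N : nat) (I : seq nat) : {mpoly rat[N]} :=
  \prod_(i <- I) mesym N rat i.

Definition is_composition (n : nat) (I : seq nat) : bool :=
  all (fun i => (0 < i)%N) I && (sumn I == n).

(* sum over all compositions I of n (each length l <= n, each part <= n) *)
Definition sum_comp (N n : nat) (P : seq nat -> bool)
    (F : seq nat -> {mpoly rat[N]}) : {mpoly rat[N]} :=
  \sum_(l < n.+1) \sum_(t : l.-tuple 'I_n.+1 |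
        is_composition n (map val t) && P (map val t)) F (map val t).

Definition lastpart (I : seq nat) : nat := last 0%N I.
Definition droplast (I : seq nat) : seq nat := take (size I).-1 I.

Definition wI (I : seq nat) : nat :=
  match I with
  | [::] => 1%N
  | i :: r => (i * \prod_(j <- r) (j - 1))%N
  end.

Definition sigmaI (I : seq nat) (t : nat) : nat :=
  \big[minn/sumn I]_(j < (size I).+1 | (t <= sumn (take j I))%N) sumn (take j I).

Definition ThetaI (I : seq nat) (t : nat) : nat := (sigmaI I t - t)%N.

Definition pcp_coef1 (m : nat) (I : seq nat) : rat :=
  ((m%:Z - 2) * (lastpart I)%:Z * (wI (droplast I))%:Z)%:~R.
Definition pcp_coef2 (m : nat) (I : seq nat) : rat :=
  (((lastpart I)%:Z - m%:Z + 1) * (wI (droplast I))%:Z)%:~R.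

(* Main.v *)
(* Put f_g(a) for the weight generating function of the proper colorings of a
   pendant path with g vertices attached at a vertex of color a, and P_n = X_(path_n),
   so that f_(g+1)(a) = P_(g+1) - x_a f_g(a). Coloring the clique injectively gives
     X_G / (m-2)! = sum_(a <> b) x_a x_b f_g(a) f_h(b) e_(m-2)(x without x_a, x_b).
   Since e_(k+1)(A) = e_(k+1)(A \ c) + x_c e_k(A \ c), trading a clique vertex for a
   path vertex (m -> m-1, g -> g+1) changes this sum by lollipop sums
   sum_b x_b f_h(b) e_k(x without x_b), which are explicit in the e_j and P_n, and
   induction on m expresses X_G / (m-2)! through products e_j P_a P_b.
   On the other side P_n is the sum of w_I e_I over compositions, and
   Theta_I(h+1) >= m-1 says that I = J k K with |J| <= h and |K| <= g; splitting the
   sums over compositions accordingly yields the same expression. *)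
Require Import Defs.
From mathcomp Require Import all_boot all_order all_algebra.
From mathcomp Require Import mpoly ring zify.
Import GRing.Theory Num.Theory.
Local Open Scope ring_scope.

(** * Colorings of the path-clique-path graph by the colors of the clique ends *)

Section PathWeights.
Variables (R : comNzRingType) (T : finType) (x : T -> R).

Definition esub (k : nat) (A : {set T}) : R :=
  \sum_(B : {set T} | (B \subset A) && (#|B| == k)) \prod_(i in B) x i.

Fixpoint pathw (h : nat) (a : T) : R :=
  if h is h'.+1 then \sum_(c | c != a) x c * pathw h' c else 1.

Definition pathX (n : nat) : R := if n is n'.+1 then \sum_c x c * pathw n' c else 1.
Arguments pathX : simpl never.

(* Up to the factor k!, the lollipop: a (k+1)-clique with a pendant path of length h. *)
Definition lolliX (k h : nat) : R := \sum_b x b * pathw h b * esub k [set~ b].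

(* Up to the factor k!, the path-clique-path graph with m = k+2. *)
Definition pcpX (k g h : nat) : R :=
  \sum_a \sum_(b | b != a) x a * pathw g a * (x b * pathw h b) * esub k (~: [set a; b]).

(** Adjoining [c] is a bijection from the k-subsets of [A :\ c] onto the (k+1)-subsets of [A] that
    contain [c]. *)
Lemma esub_mem k (A : {set T}) c : c \in A ->
  x c * esub k (A :\ c) =
  \sum_(B : {set T} | [&& B \subset A, #|B| == k.+1 & c \in B]) \prod_(i in B) x i.
Proof.
move=> cA; rewrite /esub mulr_sumr.
rewrite [RHS](reindex_onto (fun B => c |: B) (fun B => B :\ c)) /=; last first.
  by move=> B /and3P[_ _ cB]; rewrite setD1K.
apply: eq_big => [B|B /andP[sB _]].
  rewrite subUset sub1set cA setU11 /= andbT subsetD1.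
  case: (boolP (c \in B)) => cB /=.
    rewrite andbF; apply/esym/negbTE; rewrite !negb_and; apply/orP; right.
    by apply: contraTneq cB => <-; rewrite !inE eqxx.
  by rewrite andbT cardsU1 cB setU1K // eqxx andbT.
have cB : c \notin B by move: sB; rewrite subsetD1 => /andP[].
by rewrite big_setU1.
Qed.

Lemma esubD1 k (A : {set T}) c : c \in A ->
  esub k.+1 A = esub k.+1 (A :\ c) + x c * esub k (A :\ c).
Proof.
move=> cA; rewrite esub_mem // {1}/esub (bigID (fun B : {set T} => c \in B)) /= addrC.
congr (_ + _); apply: eq_bigl => B; last by rewrite andbA.
by rewrite subsetD1 andbAC.
Qed.

(** Double counting of pairs (c, B) with c in B: each (k+1)-subset B occurs once for each of its
    elements. *)
Lemma esub_sum k (A : {set T}) :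
  \sum_(c in A) x c * esub k (A :\ c) = k.+1%:R * esub k.+1 A.
Proof.
rewrite (eq_bigr _ (fun c cA => esub_mem k A c cA)).
rewrite (exchange_big_dep (fun B : {set T} => (B \subset A) && (#|B| == k.+1))) /=; last first.
  by move=> c B cA /and3P[-> ->].
rewrite /esub mulr_sumr; apply: eq_bigr => B /andP[sB /eqP cB].
rewrite -[k.+1 in RHS]cB -sum1_card natr_sum mulr_suml.
apply: eq_big => [c|c _]; last by rewrite mul1r.
by rewrite sB sum1_card cB eqxx /=; apply/andb_idl/(subsetP sB).
Qed.

Lemma esub0 A : esub 0 A = 1.
Proof.
rewrite /esub (big_pred1 set0) ?big_set0 // => B /=.
by rewrite cards_eq0; case: eqP => [->|]; rewrite ?sub0set ?andbF.
Qed.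

Lemma setTD1 (b : T) : [set: T] :\ b = [set~ b].
Proof. by apply/setP => c; rewrite !inE andbT. Qed.

Lemma setC1D1 (a b : T) : [set~ b] :\ a = ~: [set a; b].
Proof. by apply/setP => c; rewrite !inE negb_or. Qed.

(** Color the path freely, then remove the colorings whose first vertex repeats the color [a]. *)
Lemma pathwS h a : pathw h.+1 a = pathX h.+1 - x a * pathw h a.
Proof. by rewrite /pathX (bigD1 a) //= addrC addrK. Qed.

(** * Lollipop sums in closed form *)

Lemma lolliX_h0 k : lolliX k 0 = k.+1%:R * esub k.+1 setT.
Proof.
rewrite -esub_sum; apply: eq_big => [b|b _]; first by rewrite in_setT.
by rewrite mulr1 setTD1.
Qed.

Lemma lolliX_k0 h : lolliX 0 h = pathX h.+1.
Proof. by apply: eq_bigr => b _; rewrite esub0 mulr1. Qed.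

(** Trades a path vertex for a clique vertex: f_(h+1)(b) = P_(h+1) - x_b f_h(b), and x_b e_k without
    x_b equals e_(k+1) minus e_(k+1) without x_b. Iterating down to h = 0 gives [lolliXE]. *)
Lemma lolliX_hS k h :
  lolliX k h.+1 = lolliX k.+1 h + k%:R * (esub k.+1 setT * pathX h.+1).
Proof.
(* Written this way both terms are sums over b, so the identity can be checked for each b. *)
have -> : k%:R * (esub k.+1 setT * pathX h.+1) =
    pathX h.+1 * lolliX k 0 - esub k.+1 setT * pathX h.+1.
  by rewrite lolliX_h0 -[in RHS]natr1; ring.
rewrite [in X in _ + (_ - X)]/pathX /lolliX !mulr_sumr -sumrB -big_split /=.
apply: eq_bigr => b _; rewrite -/(pathw h.+1 b) pathwS (esubD1 k setT b) ?inE // setTD1.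
ring.
Qed.

(** The factor that a part j other than the first contributes to w_I e_I. *)
Definition cE (j : nat) : R := (j%:R - 1) * esub j setT.

Lemma lolliXE k h :
  lolliX k h = esub (k + h).+1 setT + \sum_(b < h.+1) cE ((k + h).+1 - b) * pathX b.
Proof.
elim: h k => [|h IH] k.
  by rewrite lolliX_h0 big_ord1 addn0 subn0 /cE -natr1 /pathX /=; ring.
rewrite lolliX_hS IH [in RHS]big_ord_recr /= addSnnS.
rewrite addrA; congr (_ + _).
have -> : ((k + h.+1).+1 - h.+1 = k.+1)%N by lia.
rewrite /cE -natr1; ring.
Qed.

Lemma pathXS h :
  pathX h.+1 = esub h.+1 setT + \sum_(b < h.+1) cE (h.+1 - b) * pathX b.
Proof. by rewrite -lolliX_k0 lolliXE. Qed.

(* Telescoping f_(p+1) f_q - f_p f_(q+1) = P_(p+1) f_q - P_(q+1) f_p in p. *)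
Lemma pathwM p q a :
  pathw p a * pathw q a =
  \sum_(k < p.+1) pathX k * pathw (p + q - k) a
  - \sum_(k < p) pathX (q + k.+1) * pathw (p - k.+1) a.
Proof.
elim: p q => [|p IH] q; first by rewrite big_ord1 big_ord0 add0n subn0 subr0.
have -> : pathw p.+1 a * pathw q a =
    pathw p a * pathw q.+1 a + pathX p.+1 * pathw q a - pathX q.+1 * pathw p a.
  by rewrite !pathwS; ring.
rewrite IH [in RHS]big_ord_recr [in X in _ = _ - X]big_ord_recl /=.
rewrite addSnnS.
have -> : (p + q.+1 - p.+1 = q)%N by lia.
rewrite subSS subn0 addn1.
have -> : \sum_(i < p) pathX (q + (bump 0 i).+1) * pathw (p.+1 - (bump 0 i).+1) a =
  \sum_(k < p) pathX (q.+1 + k.+1) * pathw (p - k.+1) a.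
  by apply: eq_bigr => i _; congr (pathX _ * pathw _ a); rewrite /bump /=; lia.
ring.
Qed.

(** Two paths hanging at the same clique vertex reduce, through [pathwM], to single-path
    lollipops. *)
Lemma sum_pathwM k p q :
  \sum_b x b * (pathw p b * pathw q b) * esub k [set~ b] =
  \sum_(i < p.+1) pathX i * lolliX k (p + q - i)
  - \sum_(i < p) pathX (q + i.+1) * lolliX k (p - i.+1).
Proof.
transitivity (\sum_b (\sum_(i < p.+1) pathX i * (x b * pathw (p + q - i) b * esub k [set~ b])
  - \sum_(i < p) pathX (q + i.+1) * (x b * pathw (p - i.+1) b * esub k [set~ b]))).
  apply: eq_bigr => b _; rewrite pathwM; move: (esub k _) => e.
  rewrite mulrBr mulrBl !mulr_sumr !mulr_suml.
  by congr (_ - _); apply: eq_bigr => i _; ring.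
rewrite sumrB; congr (_ - _); rewrite exchange_big; apply: eq_bigr => i _ /=;
  by rewrite /lolliX mulr_sumr.
Qed.

(** * Recursion on the clique size, with its boundary cases *)

Lemma pcpX_g0 k h : pcpX k 0 h = k.+1%:R * lolliX k.+1 h.
Proof.
rewrite /pcpX (exchange_big_dep predT) //= /lolliX mulr_sumr.
apply: eq_bigr => b _.
transitivity (x b * pathw h b * \sum_(a in [set~ b]) x a * esub k ([set~ b] :\ a)).
  rewrite mulr_sumr; apply: eq_big => [a|a _]; first by rewrite !inE eq_sym.
  by rewrite setC1D1; ring.
by rewrite esub_sum; ring.
Qed.

(** For fixed b, replace e_(k+1) without x_a, x_b by e_(k+1) without x_b minus x_a times e_k without
    x_a, x_b. The first term no longer sees a, so summing over a completes f_(g+1)(b); in the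
    second, x_a f_g(a) = P_(g+1) - f_(g+1)(a). *)
Lemma pcpX_rec k g h :
  pcpX k.+1 g h = pcpX k g.+1 h - pathX g.+1 * pcpX k 0 h
    + \sum_b x b * (pathw g.+1 b * pathw h b) * esub k.+1 [set~ b].
Proof.
have swap i p q : pcpX i p q =
    \sum_b \sum_(a | a != b) x a * pathw p a * (x b * pathw q b) * esub i (~: [set a; b]).
  rewrite /pcpX (exchange_big_dep predT) //=; apply: eq_bigr => b _.
  by apply: eq_bigl => a; rewrite eq_sym.
rewrite !swap mulr_sumr -sumrB -big_split /=.
apply: eq_bigr => b _.
rewrite mulr_sumr !mulr_suml mulr_sumr mulr_suml -sumrB -big_split /=.
apply: eq_bigr => a ab.
rewrite (esubD1 k [set~ b] a) ?inE // setC1D1 -/(pathw g.+1 a) pathwS; ring.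
Qed.

(** The clique is a single edge. Summing out either of its ends shows that a vertex may move from
    one arm to the other, until g = 0. *)
Lemma pcpX_k0 g h : pcpX 0 g h = pathX (g + h).+2.
Proof.
have Yl p q : pcpX 0 p q = \sum_a x a * pathw p a * pathw q.+1 a.
  by apply: eq_bigr => a _; rewrite mulr_sumr; apply: eq_bigr => b _; rewrite esub0 mulr1.
have Yr p q : pcpX 0 p q = \sum_b x b * pathw q b * pathw p.+1 b.
  rewrite /pcpX (exchange_big_dep predT) //=; apply: eq_bigr => b _.
  rewrite mulr_sumr; apply: eq_big => [a|a _]; first by rewrite eq_sym.
  by rewrite esub0 mulr1 mulrC.
elim: g h => [|g IH] h; first by rewrite Yl; apply: eq_bigr => b _; rewrite mulr1.
rewrite addSnnS -IH Yl Yr; apply: eq_bigr => b _; ring.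
Qed.

(** * Rearrangement of double sums and the closed form in products e_j P_a P_b *)

Lemma sum_triangle M (W : nat -> nat -> R) :
  \sum_(i < M) \sum_(j < M - i) W i j = \sum_(j < M) \sum_(i < M - j) W i j.
Proof.
transitivity (\sum_(i < M) \sum_(j < M | (i + j < M)%N) W i j).
  apply: eq_bigr => i _; rewrite (big_ord_widen M) ?leq_subr //.
  by apply: eq_bigl => j; rewrite ltn_subRL.
rewrite (exchange_big_dep predT) //=; apply: eq_bigr => j _.
rewrite [RHS](big_ord_widen M (W^~ j)) ?leq_subr //.
by apply: eq_bigl => i; rewrite ltn_subRL addnC.
Qed.

(** Cut the first region at j = q: what lies beyond the rectangle is a triangle, and its reflection
    in the diagonal is the subtracted sum. *)
Lemma sum_hook p q (V : nat -> nat -> R) : (forall i j, V i j = V j i) ->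
  \sum_(i < p.+1) \sum_(j < (p + q).+1 - i) V i j
  - \sum_(i < p) \sum_(j < p - i) V (q + i.+1)%N j
  = \sum_(i < q.+1) \sum_(j < p.+1) V i j.
Proof.
move=> symV; rewrite [RHS]exchange_big /=.
transitivity (\sum_(i < p.+1) (\sum_(j < q.+1) V i j + \sum_(j < p - i) V i (q + j.+1)%N)
  - \sum_(i < p) \sum_(j < p - i) V (q + i.+1)%N j).
  congr (_ - _); apply: eq_bigr => i _.
  have -> : ((p + q).+1 - i = q.+1 + (p - i))%N by have := ltn_ord i; lia.
  rewrite big_split_ord /=; congr (_ + _); apply: eq_bigr => j _.
  by rewrite addSnnS.
rewrite big_split /= [in X in _ + X - _]big_ord_recr /= subnn big_ord0 addr0.
rewrite (sum_triangle p (fun i j => V i (q + j.+1)%N)).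
under [X in _ + X - _]eq_bigr do under eq_bigr do rewrite symV.
rewrite addrK; apply: eq_bigr => i _; exact: eq_bigr.
Qed.

(* Equal to the sum over the compositions I of n with no partial sum strictly between
   h and n - g of (last part) * w(other parts) * e_I, see gap_csum; the last three
   terms correct the pairs with a = 0 or b = 0. *)
Definition gapX (n g h : nat) : R :=
  \sum_(a < h.+1) \sum_(b < g.+1) cE (n - (a + b)) * (pathX a * pathX b)
  + \sum_(a < h.+1) pathX a * esub (n - a) setT
  + \sum_(b < g.+1) pathX b * esub (n - b) setT - esub n setT.

(** Induction on k for all g, since [pcpX_rec] lowers k while raising g; n stays fixed. *)
Lemma pcpXE k g h : let n := (g + h + k).+2 in
  pcpX k g h = k.+1%:R * esub n setT + k%:R * gapX n g h
    + \sum_(t < (g + h).+2) ((g + h).+1 - t)%:R * (pathX t * esub (n - t) setT).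
Proof.
elim: k g => [|k IH] g /=.
  rewrite addn0 pcpX_k0 pathXS !mul1r mul0r addr0; congr (_ + _).
  apply: eq_bigr => t _; rewrite /cE.
  by rewrite subSn -?natr1 ?addrK; [ring|rewrite -ltnS].
rewrite pcpX_rec pcpX_g0 sum_pathwM IH.
set n := (g + h + k.+1).+2.
have -> : (g.+1 + h + k).+2 = n by rewrite /n; lia.
pose U i := pathX i * esub (n - i) setT.
pose V i j := cE (n - (i + j)) * (pathX i * pathX j).
have symV i j : V i j = V j i by rewrite /V addnC [pathX i * _]mulrC.
have LE i : (i <= g.+1 + h)%N ->
    pathX i * lolliX k.+1 (g.+1 + h - i) = U i + \sum_(j < (g.+1 + h).+1 - i) V i j.
  move=> le_i; rewrite lolliXE mulrDr /U.
  rewrite (subSn le_i) (_ : (k.+1 + (g.+1 + h - i)).+1 = (n - i)%N); last by rewrite /n; lia.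
  by congr (_ + _); rewrite mulr_sumr; apply: eq_bigr => j _; rewrite /V subnDA; ring.
have S1 : \sum_(i < g.+2) pathX i * lolliX k.+1 (g.+1 + h - i) =
    \sum_(i < g.+2) U i + \sum_(i < g.+2) \sum_(j < (g.+1 + h).+1 - i) V i j.
  by rewrite -big_split /=; apply: eq_bigr => i _; apply: LE; have := ltn_ord i; lia.
have S2 : \sum_(i < g.+1) pathX (h + i.+1) * lolliX k.+1 (g.+1 - i.+1) =
    \sum_(i < g.+1) U (h + i.+1)%N + \sum_(i < g.+1) \sum_(j < g.+1 - i) V (h + i.+1)%N j.
  rewrite -big_split /=; apply: eq_bigr => i _.
  have lt_i := ltn_ord i.
  have -> : (g.+1 - i.+1 = g.+1 + h - (h + i.+1))%N by lia.
  rewrite LE; last lia.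
  by have -> : ((g.+1 + h).+1 - (h + i.+1) = g.+1 - i)%N by lia.
(* Raising g by one raises every coefficient by one; the new top term has coefficient 0. The excess
   is cut at h + 1 to match the single sums of [S2] and [S5]. *)
have S3 : \sum_(t < (g.+1 + h).+2) ((g.+1 + h).+1 - t)%:R * U t =
    \sum_(t < (g + h).+2) ((g + h).+1 - t)%:R * U t
    + \sum_(i < h.+1) U i + \sum_(i < g.+1) U (h + i.+1)%N.
  rewrite big_ord_recr /= subnn mul0r addr0 -addrA.
  have -> : \sum_(i < h.+1) U i + \sum_(i < g.+1) U (h + i.+1)%N = \sum_(t < (g + h).+2) U t.
    have -> : (g + h).+2 = (h.+1 + g.+1)%N by lia.
    by rewrite big_split_ord /=; congr (_ + _); apply: eq_bigr => i _; rewrite addnS.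
  rewrite -big_split /=; apply: eq_bigr => t _.
  have lt_t := ltn_ord t; have -> : ((g.+1 + h).+1 - t = ((g + h).+1 - t).+1)%N by lia.
  by rewrite -natr1; ring.
(* The terms with b = g + 1 form a lollipop sum, which cancels the [pcpX k 0 h] term of the
   recursion. *)
have S4 : gapX n g.+1 h = gapX n g h + pathX g.+1 * lolliX k.+1 h.
  rewrite lolliXE /gapX [in X in X + _ + _ - _ = _]exchange_big.
  rewrite [in X in X + _ + _ - _]big_ord_recr /=.
  rewrite [in X in _ + _ + X - _ = _]big_ord_recr /=.
  rewrite [in X in _ = X + _ + _ - _ + _]exchange_big /=.
  rewrite mulrDr [X in _ = _ + (_ + X)]mulr_sumr.
  have -> : (n - g.+1 = (k.+1 + h).+1)%N by rewrite /n; lia.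
  have -> : \sum_(i < h.+1) cE (n - (i + g.+1)) * (pathX i * pathX g.+1) =
    \sum_(i < h.+1) pathX g.+1 * (cE ((k.+1 + h).+1 - i) * pathX i).
    apply: eq_bigr => i _; have -> : (n - (i + g.+1) = (k.+1 + h).+1 - i)%N by rewrite /n; lia.
    ring.
  ring.
(* By [sum_hook], the two triangular sums of [S1] and [S2] differ by the rectangle that is the
   double sum of [gapX n g.+1 h]. *)
have S5 : \sum_(i < g.+2) \sum_(j < (g.+1 + h).+1 - i) V i j =
    gapX n g.+1 h - \sum_(i < h.+1) U i - \sum_(i < g.+2) U i + esub n setT
    + \sum_(i < g.+1) \sum_(j < g.+1 - i) V (h + i.+1)%N j.
  apply/eqP; rewrite -subr_eq (sum_hook g.+1 h V symV) /gapX; apply/eqP.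
  rewrite /U /V; ring.
rewrite S1 S2 S3 S5 S4 -[k.+2%:R]natr1 -[k.+1%:R]natr1 /U; ring.
Qed.

End PathWeights.

Arguments esub {R T} x k A.
Arguments pathw {R T} x h a.
Arguments pathX {R T} x n.
Arguments pcpX {R T} x k g h.
Arguments cE {R T} x j.
Arguments gapX {R T} x n g h.

(** * Proper colorings as color sequences *)

Section SeqSum.
Variables (R : comNzRingType) (T : finType).

Fixpoint seqsum (n : nat) (F : seq T -> R) : R :=
  if n is n'.+1 then \sum_c seqsum n' (fun s => F (c :: s)) else F [::].

Lemma eq_seqsum n F G : (forall s, size s = n -> F s = G s) -> seqsum n F = seqsum n G.
Proof.
elim: n F G => [|n IH] F G eqFG /=; first exact: eqFG.
by apply: eq_bigr => c _; apply: IH => s sz; apply: eqFG; rewrite /= sz.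
Qed.

Lemma seqsum_cat a b F :
  seqsum (a + b) F = seqsum a (fun s => seqsum b (fun t => F (s ++ t))).
Proof. by elim: a F => [|a IH] F //=; apply: eq_bigr => c _; rewrite IH. Qed.

Lemma seqsum_rcons n F : seqsum n.+1 F = seqsum n (fun s => \sum_c F (rcons s c)).
Proof.
rewrite -addn1 seqsum_cat; apply: eq_seqsum => s _ /=.
by apply: eq_bigr => c _; rewrite cats1.
Qed.

Lemma seqsum_mull n y F : seqsum n (fun s => y * F s) = y * seqsum n F.
Proof.
elim: n F => [|n IH] F //=; rewrite mulr_sumr; apply: eq_bigr => c _; exact: IH.
Qed.

Lemma seqsum_eq0 n F : (forall s, F s = 0) -> seqsum n F = 0.
Proof.
by elim: n F => [|n IH] F F0 /=; [exact: F0|apply: big1 => c _; apply: IH => s].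
Qed.

Lemma seqsum_sum (I : finType) (P : pred I) n (F : I -> seq T -> R) :
  seqsum n (fun s => \sum_(i | P i) F i s) = \sum_(i | P i) seqsum n (F i).
Proof.
elim: n F => [|n IH] F //=; rewrite exchange_big; apply: eq_bigr => c _ /=; exact: IH.
Qed.

Lemma sum_tuple_seqsum n (F : seq T -> R) : \sum_(t : n.-tuple T) F t = seqsum n F.
Proof.
elim: n F => [|n IH] F /=.
  by rewrite (big_pred1 [tuple]) // => t; apply/esym/eqP; rewrite [t]tuple0.
under [RHS]eq_bigr do rewrite -IH.
rewrite pair_big /= (reindex (fun p : T * n.-tuple T => [tuple of p.1 :: p.2])) /=.
  by apply: eq_bigr.
exists (fun t => (thead t, [tuple of behead t])) => [[c t] _|t _] /=.
  by congr (_, _); apply: val_inj.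
by rewrite -tuple_eta.
Qed.

Lemma sum_ffun_seqsum n (F : seq T -> R) :
  \sum_(k : {ffun 'I_n -> T}) F (map k (enum 'I_n)) = seqsum n F.
Proof.
rewrite -sum_tuple_seqsum (reindex (fun t : n.-tuple T => [ffun i => tnth t i])) /=.
  apply: eq_bigr => t _; congr F.
  rewrite -[RHS](map_tnth_enum t); apply: eq_map => i; by rewrite ffunE.
exists (fun k : {ffun 'I_n -> T} => [tuple k i | i < n]) => [t _|k _] /=.
  by apply: eq_from_tnth => i; rewrite tnth_mktuple ffunE.
by apply/ffunP => i; rewrite ffunE tnth_mktuple.
Qed.

End SeqSum.

Arguments seqsum {R T} n F.

(** * Weights of the arms, of the clique and of the whole graph *)

Section Coloring.
Variables (R : comNzRingType) (T : finType) (x : T -> R).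

Let neq : rel T := fun a b => a != b.
Let wt (s : seq T) : R := \prod_(c <- s) x c.

Lemma seqsum_path h b :
  seqsum h (fun s => (path neq b s)%:R * wt s) = pathw x h b.
Proof.
elim: h b => [|h IH] b /=; first by rewrite /wt big_nil mulr1.
rewrite [RHS]big_mkcond; apply: eq_bigr => c _.
rewrite -IH -seqsum_mull eq_sym; case: ifP => bc; last first.
  by apply: seqsum_eq0 => s; rewrite /neq bc mul0r.
by apply: eq_seqsum => s _; rewrite /neq bc /= /wt big_cons; ring.
Qed.

Lemma seqsum_sorted_rcons g a :
  seqsum g (fun s => (sorted neq (rcons s a))%:R * wt s) = pathw x g a.
Proof.
elim: g a => [|g IH] a; first by rewrite /= /wt big_nil mulr1.
rewrite seqsum_rcons seqsum_sum /= [RHS]big_mkcond; apply: eq_bigr => c _.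
rewrite -IH -seqsum_mull; case: ifP => ca; last first.
  apply: seqsum_eq0 => -[|e s] /=; first by rewrite /neq ca mul0r.
  by rewrite rcons_path last_rcons /neq ca andbF mul0r.
apply: eq_seqsum => s _; rewrite [wt (rcons _ _)]/wt big_rcons /= -/(wt s).
case: s => [|e s] /=; first by rewrite /neq ca /=; ring.
by rewrite [path _ _ (rcons (rcons _ _) _)]rcons_path last_rcons /neq ca andbT; ring.
Qed.

(** Each k-subset of [A] is listed in k! orders; the induction chooses the first color and uses
    [esub_sum]. *)
Lemma seqsum_uniq k (A : {set T}) :
  seqsum k (fun s => (uniq s && all (fun c => c \in A) s)%:R * wt s) = k`!%:R * esub x k A.
Proof.
elim: k A => [|k IH] A; first by rewrite esub0 /= /wt big_nil !mulr1.
rewrite factS natrM mulrAC mulrC -esub_sum mulr_sumr /= [RHS]big_mkcond.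
apply: eq_bigr => c _; case: ifP => cA; last first.
  by apply: seqsum_eq0 => s; rewrite /= andbF mul0r.
rewrite mulrCA -IH -seqsum_mull; apply: eq_seqsum => s _.
rewrite /= /wt big_cons -/(wt s) mulrCA; congr (_ * (_%:R * _)).
have -> : all (fun d => d \in A :\ c) s = (c \notin s) && all (fun c => c \in A) s.
  rewrite -has_pred1 -all_predC -all_predI; apply: eq_all => d /=.
  by rewrite !inE.
by case: (c \notin s); rewrite /= ?andbF.
Qed.

(** The three kinds of edges live on three windows of consecutive vertices, which overlap exactly in
    u = g and v = g+m-1. *)
Lemma proper_pcp_nth x0 g h m (s : seq T) : (1 < m)%N -> size s = (g + h + m)%N ->
  (forall i j, (i < g + h + m)%N -> (j < g + h + m)%N -> pcp_adj g h m i j ->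
     nth x0 s i != nth x0 s j) <->
  [&& sorted neq (take g.+1 s), uniq (take m (drop g s)) & sorted neq (drop (g + m).-1 s)].
Proof.
move=> m1 sz; split => [H|/and3P[s1 u s2] i j lti ltj].
  apply/and3P; split.
  - apply/(sortedP x0) => i; rewrite size_take_min sz => lti.
    rewrite !nth_take //; try lia.
    by apply: H; rewrite /pcp_adj; lia.
  - apply/(uniqP x0) => i j; rewrite !inE size_take_min size_drop sz => lti ltj.
    rewrite !nth_take ?nth_drop; try lia.
    apply: contra_eq => ij; apply: H; rewrite /pcp_adj; lia.
  - apply/(sortedP x0) => i; rewrite size_drop sz => lti.
    rewrite !nth_drop; apply: H; rewrite /pcp_adj; lia.
have edge1 i' : (i' < g)%N -> nth x0 s i' != nth x0 s i'.+1.
  move=> lti'; have := sortedP x0 s1 i'; rewrite size_take_min sz !nth_take; try lia.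
  by apply; lia.
have edge2 i' : (g + m - 1 <= i')%N -> (i'.+1 < g + h + m)%N -> nth x0 s i' != nth x0 s i'.+1.
  move=> le_i' lti'; have := sortedP x0 s2 (i' - (g + m - 1))%N.
  rewrite size_drop sz !nth_drop.
  have -> : ((g + m).-1 + (i' - (g + m - 1)) = i')%N by lia.
  have -> : ((g + m).-1 + (i' - (g + m - 1)).+1 = i'.+1)%N by lia.
  by apply; lia.
case/andP => ij /or3P[/andP[/andP[ig jg] /orP[] /eqP e]|/andP[/andP[/andP[ig im] jg] jm]|/andP[/andP[ig jg] /orP[] /eqP e]].
- by rewrite e eq_sym edge1 //; lia.
- by rewrite e edge1 //; lia.
- have := uniqP x0 u (i - g)%N (j - g)%N.
  rewrite !inE size_take_min size_drop sz !nth_take ?nth_drop; try lia.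
  rewrite !subnKC // => inj; apply/eqP => eqs.
  suff : (i - g = j - g)%N by lia.
  by apply: inj => //; lia.
- by rewrite e eq_sym edge2 //; lia.
- by rewrite e edge2 //; lia.
Qed.

Lemma seqsum_pcp k g h :
  seqsum (g + h + k.+2) (fun s =>
    [&& sorted neq (take g.+1 s), uniq (take k.+2 (drop g s))
      & sorted neq (drop (g + k.+2).-1 s)]%:R * wt s)
  = k`!%:R * pcpX x k g h.
Proof.
have -> : (g + h + k.+2 = g + (k + h.+1).+1)%N by lia.
rewrite seqsum_cat.
(* Write the color sequence as p, a, d, b, q with a, b the colors of u, v and d those of the other
   clique vertices. Once a and b are fixed, the conditions on p, d and q are independent. *)
transitivity (seqsum g (fun p => \sum_a seqsum k (fun d => \sum_b seqsum h (fun q =>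
   (sorted neq (rcons p a))%:R * wt p * (a != b)%:R * (x a * x b)
   * ((uniq d && all (fun c => c \in ~: [set a; b]) d)%:R * wt d)
   * ((path neq b q)%:R * wt q))))).
  apply: eq_seqsum => p sp /=; apply: eq_bigr => a _.
  rewrite seqsum_cat; apply: eq_seqsum => d sd /=; apply: eq_bigr => b _.
  apply: eq_seqsum => q sq.
  have -> : take g.+1 (p ++ a :: d ++ b :: q) = rcons p a.
    by rewrite -cat_rcons take_size_cat // size_rcons sp.
  have -> : take k.+2 (drop g (p ++ a :: d ++ b :: q)) = a :: rcons d b.
    by rewrite drop_size_cat //= -cat_rcons take_size_cat // size_rcons sd.
  have -> : drop (g + k.+2).-1 (p ++ a :: d ++ b :: q) = b :: q.
    rewrite -cat_cons catA drop_size_cat //= size_cat /= sp sd; lia.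
  have -> : uniq (a :: rcons d b) =
     (a != b) && (uniq d && all (fun c => c \in ~: [set a; b]) d).
    rewrite /= mem_rcons rcons_uniq inE negb_or -andbA; congr (_ && _).
    have -> : all (fun c => c \in ~: [set a; b]) d = (a \notin d) && (b \notin d).
      rewrite -!has_pred1 -!all_predC -all_predI; apply: eq_all => c /=.
      by rewrite !inE negb_or.
    by case: (a \notin d); case: (b \notin d); rewrite ?andbF ?andbT.
  rewrite /wt !(big_cat, big_cons) /= -!mulnb !natrM; ring.
rewrite seqsum_sum /pcpX mulr_sumr; apply: eq_bigr => a _.
under eq_seqsum do rewrite seqsum_sum.
rewrite seqsum_sum mulr_sumr [RHS]big_mkcond; apply: eq_bigr => b _.
transitivity (seqsum g (fun p => ((a != b)%:R * (x a * x b)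
   * (k`!%:R * esub x k (~: [set a; b])) * pathw x h b) *
    ((sorted neq (rcons p a))%:R * wt p))).
  apply: eq_seqsum => p _.
  transitivity (seqsum k (fun d => ((sorted neq (rcons p a))%:R * wt p
    * (a != b)%:R * (x a * x b) * pathw x h b)
    * ((uniq d && all (fun c => c \in ~: [set a; b]) d)%:R * wt d))).
    by apply: eq_seqsum => d _; rewrite seqsum_mull seqsum_path; ring.
  by rewrite seqsum_mull seqsum_uniq; ring.
rewrite seqsum_mull seqsum_sorted_rcons eq_sym; case: (b == a) => /=; ring.
Qed.

End Coloring.

Lemma chromsym_pcp N k g h :
  chromsym _ (pcp_graph g h k.+2) N =
  k`!%:R * pcpX (fun i : 'I_N => 'X_i : {mpoly rat[N]}) k g h.
Proof.
rewrite -seqsum_pcp -sum_ffun_seqsum /chromsym big_mkcond.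
apply: eq_bigr => c _.
(* [nth] needs a default color. For N = 0 there is none, but then no coloring [c] exists, as the
   graph has a vertex. *)
have [x0 _|T0] := pickP (fun _ : 'I_N => true); last first.
  by have := T0 (c (Ordinal (ltn_addl (g + h) (ltn0Sn k.+1)))).
set s := map c _.
have sz : size s = (g + h + k.+2)%N by rewrite size_map size_enum_ord.
have sE i : nth x0 s (nat_of_ord i) = c i.
  by rewrite (nth_map i) ?size_enum_ord ?nth_ord_enum.
have -> : proper_col _ (pcp_graph g h k.+2) N c = [&& sorted (fun a b => a != b) (take g.+1 s),
   uniq (take k.+2 (drop g s)) & sorted (fun a b => a != b) (drop (g + k.+2).-1 s)].
  apply/idP/idP => [/forallP cP|].
    apply/(proper_pcp_nth _ x0 g h k.+2 s isT sz) => i j lti ltj ij.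
    have /forallP/(_ (Ordinal ltj)) := cP (Ordinal lti).
    by rewrite -!sE => /implyP; apply.
  move/(proper_pcp_nth _ x0 g h k.+2 s isT sz) => sP.
  apply/forallP => i; apply/forallP => j; apply/implyP => ij.
  by rewrite -!sE; apply: sP.
have -> : \prod_i 'X_(c i) = \prod_(a <- s) 'X_a :> {mpoly rat[N]}.
  by rewrite big_map big_enum.
by case: ifP; rewrite ?mul1r ?mul0r.
Qed.

(** * Sums over compositions *)

Section CompositionSums.
Variable (R : comNzRingType).

(** The sum over compositions of n with exactly l parts, recursive in the first part so that
    inductions need no tuples. *)
Fixpoint lsum (l n : nat) (F : seq nat -> R) : R :=
  if l is l'.+1 then \sum_(i < n) lsum l' (n - i.+1) (fun I => F (i.+1 :: I))
  else if n == 0%N then F [::] else 0.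

Definition csum (n : nat) (F : seq nat -> R) : R := \sum_(l < n.+1) lsum l n F.

Lemma lsum_gt l n F : (n < l)%N -> lsum l n F = 0.
Proof.
elim: l n F => [|l IH] n F //= ltnl; apply: big1 => i _; apply: IH.
have := ltn_ord i; lia.
Qed.

Lemma csum_widen M n F : (n < M)%N -> \sum_(l < M) lsum l n F = csum n F.
Proof.
move=> ltnM; rewrite /csum [RHS](big_ord_widen M (fun l => lsum l n F)) // [RHS]big_mkcond.
by apply: eq_bigr => l _; case: ltnP => // ltnl; rewrite lsum_gt.
Qed.

Lemma csum0 F : csum 0 F = F [::].
Proof. by rewrite /csum big_ord1. Qed.

Lemma csum_cons n F : csum n.+1 F = \sum_(i < n.+1) csum (n - i) (fun I => F (i.+1 :: I)).
Proof.
rewrite /csum big_ord_recl /= add0r exchange_big; apply: eq_bigr => i _ /=.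
rewrite subSS csum_widen // ltnS leq_subr //.
Qed.

Lemma eq_csum n F G : (forall I, is_composition n I -> F I = G I) -> csum n F = csum n G.
Proof.
move=> eqFG; apply: eq_bigr => l _; move: (nat_of_ord l) => {}l.
elim: l n F G eqFG => [|l IH] n F G eqFG /=.
  by case: eqP => // n0; apply: eqFG; rewrite n0.
apply: eq_bigr => i _; apply: IH => I /andP[I0 /eqP sI]; apply: eqFG.
by rewrite /is_composition /= I0 sI /= subnKC.
Qed.

Lemma csum_mull n y F : csum n (fun I => y * F I) = y * csum n F.
Proof.
rewrite /csum mulr_sumr; apply: eq_bigr => l _; move: (nat_of_ord l) => {}l.
elim: l n F => [|l IH] n F /=; first by case: eqP; rewrite ?mulr0.
by rewrite mulr_sumr; apply: eq_bigr => i _; rewrite IH.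
Qed.

Lemma csum_eq0 n F : (forall I, is_composition n I -> F I = 0) -> csum n F = 0.
Proof.
move=> F0; transitivity (csum n (fun I => 0 * F I)); last by rewrite csum_mull mul0r.
by apply: eq_csum => I cI; rewrite F0 ?mul0r.
Qed.

(** Fix both the first and the last part; the two orders of summation run over the same triangle.
    The one-part composition is the separate final term. *)
Lemma csum_rcons n F :
  csum n.+1 F = \sum_(j < n.+1) csum (n - j) (fun I => F (rcons I j.+1)).
Proof.
elim/ltn_ind: n F => n IH F; rewrite csum_cons !big_ord_recr /= subnn !csum0; congr (_ + _).
pose W i j := csum (n - (i + j).+1) (fun I => F (i.+1 :: rcons I j.+1)).
transitivity (\sum_(i < n) \sum_(j < n - i) W i j).
  apply: eq_bigr => i _; have lt_i := ltn_ord i.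
  have -> : (n - i = (n - i.+1).+1)%N by lia.
  rewrite IH; last lia.
  by apply: eq_bigr => j _; rewrite /W -addSn subnDA.
rewrite sum_triangle; apply: eq_bigr => j _; have lt_j := ltn_ord j.
have -> : (n - j = (n - j.+1).+1)%N by lia.
by rewrite csum_cons; apply: eq_bigr => i _; rewrite /W addnC -addSn subnDA.
Qed.

Lemma csum_rev n F : csum n F = csum n (fun I => F (rev I)).
Proof.
elim/ltn_ind: n F => -[|n] IH F; first by rewrite !csum0.
rewrite csum_cons csum_rcons; apply: eq_bigr => i _.
rewrite IH ?ltnS ?leq_subr //; apply: eq_csum => I _.
by rewrite rev_rcons.
Qed.

Lemma sum_antidiag M (G : nat -> nat -> R) :
  \sum_(a < M) \sum_(i < a.+1) G i (a - i)%N = \sum_(i < M) \sum_(j < M - i) G i j.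
Proof.
elim: M => [|M IH]; first by rewrite !big_ord0.
rewrite big_ord_recr /= IH [RHS]big_ord_recr /= [X in _ + X = _]big_ord_recr /=.
rewrite subSnn big_ord1 subnn addrA -big_split /=; congr (_ + _).
apply: eq_bigr => i _; have lt_i := ltn_ord i.
by rewrite subSn 1?ltnW // big_ord_recr.
Qed.

Lemma sum_ord_split p q (f : nat -> R) : (p <= q)%N ->
  \sum_(i < q) f i = \sum_(i < p) f i + \sum_(i < q - p) f (p + i)%N.
Proof. by move/subnKC <-; rewrite big_split_ord addKn. Qed.

(** Every composition is J p K for a unique part p with |J| <= h < |J| + p; here a = |J| and b =
    |K|. *)
Lemma csum_split n h F : (h < n)%N ->
  csum n F = \sum_(a < h.+1) \sum_(b < n - h)
    csum a (fun J => csum b (fun K => F (J ++ (n - a - b)%N :: K))).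
Proof.
elim/ltn_ind: h n F => h IH [//|n] F lt_hn.
rewrite csum_cons.
(* Either the first part is at most h and belongs to J, or it exceeds h and is p itself, with J
   empty. *)
transitivity (\sum_(i < h) csum (n - i) (fun I => F (i.+1 :: I))
  + \sum_(b < n.+1 - h) csum b (fun I => F ((n.+1 - b)%N :: I))).
  rewrite (sum_ord_split h n.+1 (fun i => csum (n - i) (fun I => F (i.+1 :: I)))) 1?ltnW //.
  congr (_ + _).
  rewrite [RHS](reindex_inj rev_ord_inj) /=; apply: eq_bigr => i _.
  have lt_i := ltn_ord i.
  have -> : (n - (h + i) = n.+1 - h - i.+1)%N by lia.
  by have -> : ((h + i).+1 = n.+1 - (n.+1 - h - i.+1))%N by lia.
rewrite [RHS]big_ord_recl addrC; congr (_ + _).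
  by apply: eq_bigr => b _; rewrite csum0 subn0.
pose G i a := \sum_(b < n.+1 - h)
  csum a (fun J => csum b (fun K => F (i.+1 :: J ++ (n - (i + a) - b)%N :: K))).
transitivity (\sum_(i < h) \sum_(a < h - i) G i a).
  apply: eq_bigr => i _; have lt_i := ltn_ord i.
  rewrite (IH (h - i.+1)%N); [|lia..].
  have -> : (h - i = (h - i.+1).+1)%N by lia.
  apply: eq_bigr => a _; rewrite /G.
  have -> : (n - i - (h - i.+1) = n.+1 - h)%N by lia.
  by apply: eq_bigr => b _; rewrite subnDA.
rewrite -sum_antidiag; apply: eq_bigr => a _.
rewrite /G exchange_big; apply: eq_bigr => b _ /=.
rewrite /bump /= csum_cons; apply: eq_bigr => i _.
have lt_i := ltn_ord i; rewrite subnKC //.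
Qed.

Section Weights.
Variable e : nat -> R.

Definition eprod (I : seq nat) : R := \prod_(i <- I) e i.

Lemma wI_rcons J k : wI (rcons J k) = (wI J * (k - (J != [::])))%N.
Proof.
case: J => [|i J] /=; first by rewrite big_nil mul1n muln1 subn0.
by rewrite -cats1 big_cat big_seq1 /= mulnA.
Qed.

(** Read from both ends, i_(-1) w is w_J times w of the reversed K times the factor of p. That
    factor is p - 1 if p is interior and p if p is first or last, which the indicators encode by
    inclusion-exclusion. *)
Lemma wI_last_mid J p K : (0 < p)%N -> all (leq 1) J ->
  (lastpart (J ++ p :: K) * wI (droplast (J ++ p :: K)))%:R =
  (wI J)%:R * (wI (rev K))%:R * (p%:R - 1 + (K == [::])%:R + (J == [::])%:R
    - (J == [::])%:R * (K == [::])%:R) :> R.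
Proof.
move=> p0 J0.
have uE s l : (lastpart (rcons s l) * wI (droplast (rcons s l)) = l * wI s)%N.
  by rewrite /lastpart last_rcons /droplast size_rcons /= -cats1 take_size_cat.
have pE : (p - 1)%:R = p%:R - 1 :> R by rewrite natrB.
case: (lastP K) => [|K' l].
  by rewrite cats1 uE natrM /=; ring.
rewrite -rcons_cons -rcons_cat uE rev_rcons /= big_rev /=.
have -> : (rcons K' l == [::]) = false by case: K' {uE}.
case: J J0 => [_|i J _] /=; first by rewrite !natrM; ring.
by rewrite big_cat big_cons /= !natrM pE; ring.
Qed.

End Weights.
End CompositionSums.

Arguments lsum {R} l n F.
Arguments csum {R} n F.
Arguments eprod {R} e I.

Lemma sigmaI_mid J p K t : (sumn J < t)%N -> (t <= sumn J + p)%N ->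
  sigmaI (J ++ p :: K) t = (sumn J + p)%N.
Proof.
move=> ltJt letJp; set I := J ++ p :: K.
have takeS : sumn (take (size J).+1 I) = (sumn J + p)%N.
  by rewrite /I -cat_rcons take_size_cat ?size_rcons // sumn_rcons.
apply/eqP; rewrite eqn_leq; apply/andP; split.
  have szI : ((size J).+1 < (size I).+1)%N by rewrite size_cat /=; lia.
  have := @Order.TotalTheory.bigmin_le_cond _ nat _ (sumn I) (Ordinal szI)
    (fun j : 'I_(size I).+1 => (t <= sumn (take j I))%N) (fun j => sumn (take j I)).
  by rewrite minEnat leEnat /= takeS => /(_ letJp).
(* Lower bound: a prefix inside J has sum below t, and any longer prefix contains J and p. The
   default value [sumn I] of the minimum also satisfies the bound. *)
apply: (big_ind (fun v => (sumn J + p <= v)%N)).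
- by rewrite sumn_cat /=; lia.
- by move=> u v; rewrite leq_min => -> ->.
move=> j lej; rewrite /I take_cat; move: lej; rewrite /I take_cat; case: ltnP => ltj.
  have : (sumn (take j J) <= sumn J)%N by rewrite -{2}(cat_take_drop j J) sumn_cat leq_addr.
  by move=> leJ /leq_trans/(_ leJ)/(leq_trans ltJt); rewrite ltnn.
rewrite sumn_cat; case: (j - size J)%N => [|j'] /=; first by rewrite addn0; lia.
by lia.
Qed.

(** * Expansion over compositions *)

Section PathExpansion.
Variables (R : comNzRingType) (T : finType) (x : T -> R).

Let e j := esub x j setT.
Let P := pathX x.

Lemma composition_nil n I : is_composition n I -> (I == [::]) = (n == 0%N).
Proof. by case: I => [|[|i] I] /andP[] //= _ /eqP <-. Qed.

(** Removing the last part of I reproduces the recursion [pathXS]; its separate term e_n raises the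
    coefficient n - 1 of the one-part composition to n. *)
Lemma pathX_csum n : P n = csum n (fun I => (wI I)%:R * eprod e I).
Proof.
elim/ltn_ind: n => -[|n] IH; first by rewrite csum0 /eprod big_nil mulr1.
rewrite csum_rcons /P pathXS [in RHS](reindex_inj rev_ord_inj) /=.
transitivity (\sum_(b < n.+1) ((n.+1 - b)%:R - (b != 0%N :> nat)%:R) * e (n.+1 - b) * P b).
  rewrite !big_ord_recl /= subn0 /bump /=.
  by rewrite /cE /e /P /pathX subr0; ring.
apply: eq_bigr => b _; have lt_b := ltn_ord b.
have -> : (n - (n.+1 - b.+1) = b)%N by lia.
rewrite IH // -csum_mull; apply: eq_csum => I cI.
rewrite wI_rcons /eprod -cats1 big_cat big_seq1 /= (composition_nil _ _ cI).
have -> : ((n.+1 - b.+1).+1 = n.+1 - b)%N by lia.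
have pE : (n.+1 - b - (b != 0%N :> nat))%:R = (n.+1 - b)%:R - (b != 0%N :> nat)%:R :> R.
  by rewrite natrB // (leq_trans (leq_b1 _)) // subn_gt0.
rewrite natrM pE.
rewrite -/(e _); ring.
Qed.

Lemma last_csum k q : let n := (q + k).+1 in
  csum n (fun I => if (k.+1 <= lastpart I)%N then
    ((lastpart I - k.+1) * wI (droplast I))%:R * eprod e I else 0)
  = \sum_(t < q.+1) (q - t)%:R * (P t * e (n - t)).
Proof.
rewrite /= csum_rcons (reindex_inj rev_ord_inj) /=.
rewrite (big_ord_widen (q + k).+1 (fun t => (q - t)%:R * (P t * e ((q + k).+1 - t)))); last first.
  by rewrite ltnS leq_addr.
rewrite [RHS]big_mkcond; apply: eq_bigr => t _; have lt_t := ltn_ord t.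
have -> : (q + k - ((q + k).+1 - t.+1) = t)%N by lia.
have -> : (((q + k).+1 - t.+1).+1 = (q + k).+1 - t)%N by lia.
set p := ((q + k).+1 - t)%N.
transitivity (if (k.+1 <= p)%N then (p - k.+1)%:R * e p * P t else 0).
  case: ifP => lekp.
    rewrite pathX_csum -csum_mull; apply: eq_csum => I _.
    rewrite /lastpart last_rcons lekp /droplast size_rcons /=.
    by rewrite -cats1 take_size_cat // /eprod big_cat big_seq1 /= -/(e p) natrM; ring.
  by apply: csum_eq0 => I _; rewrite /lastpart last_rcons lekp.
have -> : (k.+1 <= p)%N = (t < q.+1)%N by rewrite /p; lia.
case: ifP => // ltq; have -> : (p - k.+1 = q - t)%N by rewrite /p; lia.
ring.
Qed.

(** Split I = J p K at the part covering position h + 1 and sum over J and K separately, which gives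
    P_a P_b. The terms of [gapX] come from the four summands in [wI_last_mid]. *)
Lemma gap_csum k g h : let n := (g + h + k).+2 in
  csum n (fun I => if (k.+1 <= ThetaI I h.+1)%N then
    (lastpart I * wI (droplast I))%:R * eprod e I else 0)
  = gapX x n g h.
Proof.
move=> n; rewrite (csum_split R n h); last by rewrite /n; lia.
transitivity (\sum_(a < h.+1) \sum_(b < g.+1)
   (cE x (n - (a + b)) * (P a * P b)
   + (if b == 0%N :> nat then P a * e (n - a) else 0)
   + (if a == 0%N :> nat then P b * e (n - b) else 0)
   - (if a == 0%N :> nat then if b == 0%N :> nat then e n else 0 else 0))).
  apply: eq_bigr => a _; have lt_a := ltn_ord a.
  rewrite [RHS](big_ord_widen (n - h) (fun b =>
    (cE x (n - (a + b)) * (P a * P b)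
    + (if b == 0%N :> nat then P a * e (n - a) else 0)
    + (if a == 0%N :> nat then P b * e (n - b) else 0)
    - (if a == 0%N :> nat then if b == 0%N :> nat then e n else 0 else 0)))); last by rewrite /n; lia.
  rewrite [RHS]big_mkcond; apply: eq_bigr => b _; have lt_b := ltn_ord b.
  set p := (n - a - b)%N.
  (* Here sigma is |J| + p = n - b, so the condition reads n - b >= h + k + 2, that is b <= g. *)
  have ThE J K : sumn J = a -> (k.+1 <= ThetaI (J ++ p :: K) h.+1)%N = (b < g.+1)%N.
    move=> sJ; rewrite /ThetaI sigmaI_mid sJ; last 2 [by lia|by rewrite /p; lia].
    by move: lt_b; rewrite /p /n; lia.
  case: ifP => ltbg; last first.
    apply: csum_eq0 => J /andP[_ /eqP sJ]; apply: csum_eq0 => K _.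
    by rewrite ThE // ltbg.
  pose c : R := (p%:R - 1 + (b == 0%N :> nat)%:R + (a == 0%N :> nat)%:R
    - (a == 0%N :> nat)%:R * (b == 0%N :> nat)%:R) * e p.
  transitivity (c * P b * P a).
    rewrite [P a]pathX_csum -csum_mull; apply: eq_csum => J cJ.
    (* P_b is expanded over reversed compositions because K enters through w of its reversal. *)
    rewrite [P b]pathX_csum [in RHS]csum_rev -csum_mull -mulrC -csum_mull.
    apply: eq_csum => K cK.
    have /andP[J0 /eqP sJ] := cJ.
    rewrite ThE // ltbg wI_last_mid //; last by rewrite /p; lia.
    rewrite (composition_nil _ _ cJ) (composition_nil _ _ cK) /c.
    rewrite /eprod big_cat big_cons /= big_rev /= -/(e p); ring.
  have pE : p = (n - (a + b))%N by rewrite /p subnDA.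
  rewrite -pE /c /cE -/(e _).
  by case: eqP => [b0|_]; case: eqP => [a0|_];
    rewrite pE ?a0 ?b0 ?addn0 ?add0n ?subn0 /P /pathX /=; ring.
have sum0 q (y : R) : \sum_(b < q.+1) (if b == 0%N :> nat then y else 0) = y.
  by rewrite big_ord_recl /= big1 ?addr0.
have sum0P (q : nat) (b : bool) (f : 'I_q.+1 -> R) :
    \sum_(a < q.+1) (if b then f a else 0) = if b then \sum_(a < q.+1) f a else 0.
  by case: b => //; rewrite big1.
under eq_bigr do rewrite sumrB !big_split /= sum0 sum0P sum0P sum0.
by rewrite sumrB !big_split /= !sum0.
Qed.

Lemma pcpX_csum k g h : let n := (g + h + k).+2 in
  pcpX x k g h = k.+1%:R * e n
  + k%:R * csum n (fun I => if (k.+1 <= ThetaI I h.+1)%N then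
      (lastpart I * wI (droplast I))%:R * eprod e I else 0)
  + csum n (fun I => if (k.+1 <= lastpart I)%N then
      ((lastpart I - k.+1) * wI (droplast I))%:R * eprod e I else 0).
Proof.
rewrite /= gap_csum pcpXE; congr (_ + _).
have -> : (g + h + k).+2 = ((g + h).+1 + k).+1 by lia.
by rewrite last_csum.
Qed.

End PathExpansion.

(** * Back to tuples and elementary symmetric polynomials; the expansion *)

Lemma sum_tuple_composition (R : comNzRingType) M l n (F : seq nat -> R) : (n < M)%N ->
  \sum_(t : l.-tuple 'I_M | is_composition n (map val t)) F (map val t) = lsum l n F.
Proof.
case: M => // M; rewrite ltnS big_mkcond => leM.
rewrite (sum_tuple_seqsum _ _ _ (fun s => if is_composition n (map val s)
  then F (map val s) else 0)).
elim: l n F leM => [|l IH] n F leM /=; first by rewrite /is_composition /= eq_sym.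
rewrite big_ord_recl (big_ord_widen M (fun i => lsum l (n - i.+1) (fun I => F (i.+1 :: I)))) //.
(* A first entry 0 is not allowed in a composition and contributes nothing. The bound M is kept
   apart from n because n drops in the induction. *)
rewrite seqsum_eq0 // add0r [RHS]big_mkcond; apply: eq_bigr => i _.
rewrite /bump /=; case: ifP => lt_in; last first.
  apply: seqsum_eq0 => s; case: ifP => // /andP[_ /eqP sn].
  by move: lt_in; rewrite -sn /= leq_addr.
rewrite -IH; last by apply: leq_trans leM; apply: leq_subr.
apply: eq_seqsum => s _; rewrite /is_composition /=.
by rewrite -{1}(subnKC lt_in) eqn_add2l.
Qed.

Lemma sum_comp_csum N n (Q : seq nat -> bool) (F : seq nat -> {mpoly rat[N]}) :
  sum_comp N n Q F = csum n (fun I => if Q I then F I else 0).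
Proof.
apply: eq_bigr => l _; rewrite big_mkcondr.
exact: (sum_tuple_composition _ n.+1 l n (fun I => if Q I then F I else 0)).
Qed.

Lemma mesym_esub N i : mesym N rat i = esub (fun i : 'I_N => 'X_i : {mpoly rat[N]}) i setT.
Proof. by rewrite /mesym /esub; apply: eq_bigl => A; rewrite subsetT. Qed.

Theorem theorem5p3 (g h m : nat) (N : nat) :
  (2 <= m)%N ->
  let n := (g + h + m)%N in
  (((m - 2)`!)%N%:R)^-1 *: chromsym _ (pcp_graph g h m) N =
    ((m%:R - 1 : rat)) *: eI N [:: n]
    + sum_comp N n (fun I => (m - 1 <= ThetaI I h.+1)%N)
        (fun I => pcp_coef1 m I *: eI N I)
    + sum_comp N n (fun I => (m - 1 <= lastpart I)%N)
        (fun I => pcp_coef2 m I *: eI N I)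
  /\ 0 <= (m%:R - 1 : rat)
  /\ (forall I, is_composition n I -> (m - 1 <= ThetaI I h.+1)%N -> 0 <= pcp_coef1 m I)
  /\ (forall I, is_composition n I -> (m - 1 <= lastpart I)%N -> 0 <= pcp_coef2 m I).
Proof.
case: m => [//|[//|k]] _ n.
have c0 : k.+2%:R - 1 = k.+1%:R :> rat by rewrite -natr1 addrK.
(* With m = k + 2 both integer coefficients become natural numbers, the second one under its
   summation condition; nonnegativity is then immediate. *)
have c1 I : pcp_coef1 k.+2 I = (k * (lastpart I * wI (droplast I)))%:R.
  by rewrite /pcp_coef1 [RHS]pmulrn; congr (_ *~ _); lia.
have c2 I : (k.+1 <= lastpart I)%N ->
    pcp_coef2 k.+2 I = ((lastpart I - k.+1) * wI (droplast I))%:R.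
  by move=> le_k; rewrite /pcp_coef2 [RHS]pmulrn; congr (_ *~ _); rewrite PoszM -subzn //; congr (_ * _); lia.
rewrite !subSS !subn0 c0; split; last first.
  by split; [|split=> I _ leI]; rewrite ?c1 ?c2.
have eE I : eI N I = eprod (fun j => esub (fun i : 'I_N => 'X_i : {mpoly rat[N]}) j setT) I.
  by apply: eq_bigr => i _; rewrite mesym_esub.
rewrite chromsym_pcp mulr_natl -scaler_nat scalerA mulVf ?scale1r; last first.
  by rewrite pnatr_eq0 -lt0n fact_gt0.
rewrite pcpX_csum !sum_comp_csum -csum_mull.
have -> : (g + h + k).+2 = n by rewrite /n; lia.
rewrite eE /eprod big_seq1 scaler_nat mulr_natl.
congr (_ + _ + _); apply: eq_csum => I _; rewrite eE.
  by case: ifP => _; rewrite ?mulr0 // c1 scaler_nat -[RHS]mulr_natl [in RHS]natrM mulrA.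
by case: ifP => // leI; rewrite c2 // scaler_nat mulr_natl.
Qed.
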